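(* Let $\mathcal K$ be a nonempty, isomorphism-closed class of ordered structures of the same type which has the superamalgamation property with respect to its order $\leq$. Let $Q\subseteq\{2,4,5\}$ and $N\subseteq\{F,C,A1,A2\}$, and suppose that at least one of the following holds: (a) $\{A1,A2\}\subseteq N$; (b) $A1\notin N$ and $A2\notin N$; (c1) $F\in N$. Let $\mathcal K_{Q,N}$ be the class of all expansions of members of $\mathcal K$ by a further binary relation $\ll$ such that $\ll$ is transitive, $\ll$ satisfies the properties in $Q$, and the conditions in $N$ hold. Then $\mathcal K_{Q,N}$ has the superamalgamation property with respect to $\leq$.
   Context: An ordered structure is a structure with a partial order $\leq$ and possibly further relations, functions and constants. Properties of a binary relation $R$: 2 means reflexive; 4 means antireflexive; 5 means antisymmetric. Conditions in $N$: $F$: $x\ll y\Rightarrow x\leq y$; $C$: $x\leq y\Rightarrow x\ll y$; $A1$: $w\leq x\ll y$ implies $w\ll y$; $A2$: $x\ll y\leq z$ implies $x\ll z$. A class has the superamalgamation property with respect to $\leq$ if for all members $\mathbf A,\mathbf B,\mathbf C$ and embeddings $\iota_1:\mathbf C\to\mathbf A$, $\kappa_1:\mathbf C\to\mathbf B$ there are a member $\mathbf D$ and embeddings $\iota:\mathbf A\to\mathbf D$, $\kappa:\mathbf B\to\mathbf D$ with $\iota\circ\iota_1=\kappa\circ\kappa_1$, $\iota(A)\cap\kappa(B)=\iota(\iota_1(C))$, and such that for all $a\in A\setminus\iota_1(C)$, $b\in B\setminus\kappa_1(C)$: if $\iota(a)\leq^{\mathbf D}\kappa(b)$ then some $c\in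 C$ has $a\leq^{\mathbf A}\iota_1(c)$ and $\kappa_1(c)\leq^{\mathbf B} b$; and if $\kappa(b)\leq^{\mathbf D}\iota(a)$ then some $c\in C$ has $b\leq^{\mathbf B}\kappa_1(c)$ and $\iota_1(c)\leq^{\mathbf A} a$. *)

(* Defs.v *)
From Stdlib Require Import Relations.
From Stdlib Require Vector.

Set Implicit Arguments.
Unset Strict Implicit.
Unset Printing Implicit Defensive.

(* The type of an ordered structure, apart from the order symbol itself, which
   every ordered structure carries.  Constants are function symbols of arity 0. *)
Record signature := Signature {
  rel_symb : Type;
  rel_arity : rel_symb -> nat;
  fun_symb : Type;
  fun_arity : fun_symb -> nat
}.

(* The carrier may be empty; a class K may of course contain nonempty
   structures only. *)
Record ordered_structure (S : signature) := OrderedStructure {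
  carrier :> Type;
  le : carrier -> carrier -> Prop;
  le_order : order carrier le;
  rel_interp : forall r : rel_symb S, Vector.t carrier (rel_arity r) -> Prop;
  fun_interp : forall f : fun_symb S, Vector.t carrier (fun_arity f) -> carrier
}.

Record is_embedding (S : signature) (A B : ordered_structure S) (h : A -> B)
  : Prop := {
  emb_inj : forall x y : A, h x = h y -> x = y;
  emb_le : forall x y : A, le x y <-> le (h x) (h y);
  emb_rel : forall (r : rel_symb S) (v : Vector.t A (rel_arity r)),
    rel_interp v <-> rel_interp (Vector.map h v);
  emb_fun : forall (f : fun_symb S) (v : Vector.t A (fun_arity f)),
    h (fun_interp v) = fun_interp (Vector.map h v)
}.

Definition isomorphic (S : signature) (A B : ordered_structure S) : Prop :=
  exists h : A -> B, is_embedding h /\ forall b : B, exists a : A, h a = b.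

Definition structure_class (S : signature) := ordered_structure S -> Prop.

Definition nonempty_class (S : signature) (K : structure_class S) : Prop :=
  exists A : ordered_structure S, K A.

Definition iso_closed (S : signature) (K : structure_class S) : Prop :=
  forall A B : ordered_structure S, K A -> isomorphic A B -> K B.

Definition in_image (X Y : Type) (f : X -> Y) (y : Y) : Prop :=
  exists x : X, f x = y.

Definition superamalgamation (S : signature) (K : structure_class S) : Prop :=
  forall (A B C : ordered_structure S) (iota1 : C -> A) (kappa1 : C -> B),
    K A -> K B -> K C -> is_embedding iota1 -> is_embedding kappa1 ->
    exists (D : ordered_structure S) (iota : A -> D) (kappa : B -> D),
      K D /\ is_embedding iota /\ is_embedding kappa /\
      (forall c : C, iota (iota1 c) = kappa (kappa1 c)) /\
      (forall d : D, in_image iota d /\ in_image kappa d <->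
                     in_image (fun c : C => iota (iota1 c)) d) /\
      (forall (a : A) (b : B), ~ in_image iota1 a -> ~ in_image kappa1 b ->
         (le (iota a) (kappa b) ->
            exists c : C, le a (iota1 c) /\ le (kappa1 c) b) /\
         (le (kappa b) (iota a) ->
            exists c : C, le b (kappa1 c) /\ le (iota1 c) a)).

(* The expanded type: [None] is the new binary symbol, interpreted by <<. *)
Definition add_binary (S : signature) : signature :=
  @Signature (option (rel_symb S))
    (fun r => match r with None => 2 | Some r => rel_arity r end)
    (fun_symb S) (@fun_arity S).

Definition reduct (S : signature) (M : ordered_structure (add_binary S))
  : ordered_structure S :=
  @OrderedStructure S (carrier M) (@le _ M) (le_order M)
    (fun r => @rel_interp _ M (Some r)) (@fun_interp _ M).

Definition ll (S : signature) (M : ordered_structure (add_binary S)) (x y : M)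
  : Prop :=
  @rel_interp _ M None (Vector.cons M x 1 (Vector.cons M y 0 (Vector.nil M))).

Inductive rel_property := P2 | P4 | P5.

Definition rel_property_holds (p : rel_property) (X : Type) (R : relation X)
  : Prop :=
  match p with
  | P2 => reflexive X R
  | P4 => forall x : X, ~ R x x
  | P5 => antisymmetric X R
  end.

Inductive condition := F | C | A1 | A2.

Definition condition_holds (n : condition) (X : Type) (leX llX : relation X)
  : Prop :=
  match n with
  | F => forall x y : X, llX x y -> leX x y
  | C => forall x y : X, leX x y -> llX x y
  | A1 => forall w x y : X, leX w x -> llX x y -> llX w y
  | A2 => forall x y z : X, llX x y -> leX y z -> llX x z
  end.

Definition expansion_class (S : signature) (K : structure_class S)
    (Q : rel_property -> Prop) (N : condition -> Prop)
  : structure_class (add_binary S) :=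
  fun M =>
    K (reduct M) /\
    transitive M (@ll S M) /\
    (forall p : rel_property, Q p -> rel_property_holds p (@ll S M)) /\
    (forall n : condition, N n -> condition_holds n (@le _ M) (@ll S M)).

(* Main.v *)
(** Amalgamate the reducts in K to some D and view A and B as subsets of D with
    intersection C.  If << absorbs an order L on both sides, in A and in B, and L
    interpolates over C between A and B, then a chain of <<-steps and L-steps
    alternating between A and B can be shortened, through elements of C, to at
    most one step in A and one in B.  Hence the relation on D generated by <<^A,
    <<^B and L adds no pair inside A or B, and antireflexivity and antisymmetry
    survive.  Take L to be <= when A1 and A2 hold in A and B (which C implies, by
    transitivity), and equality when none of A1, A2, C is required: superamalgams
    interpolate both relations.  When F holds with only one of A1, A2, the
    relation (<=)o(<<^A u <<^B), or its dual, does. *)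

From Stdlib Require Import Relations Classical.
From Stdlib Require Vector.
Require Import Defs.

Set Implicit Arguments.
Unset Strict Implicit.
Unset Printing Implicit Defensive.

(** * Amalgamating transitive relations over an absorbed order *)

(** [R] is a relation on all of [D] with support in [U], so that A and B can be handled as subsets
    of one set; absorption is therefore asked only at outer points in [U]. *)
Record absorbing (D : Type) (L : relation D) (U : D -> Prop) (R : relation D)
  : Prop := {
  abs_supp : forall x y, R x y -> U x /\ U y;
  abs_trans : forall x y z, R x y -> R y z -> R x z;
  abs_left : forall w x y, U w -> L w x -> R x y -> R w y;
  abs_right : forall x y z, U z -> R x y -> L y z -> R x z
}.

(** For [L] equal to <= this is the superamalgamation clause, read inside D with [z] in the common
    part. *)
Definition interpolates (D : Type) (L : relation D) (U V : D -> Prop) : Prop :=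
  forall x y, U x -> V y -> L x y -> exists z, U z /\ V z /\ L x z /\ L z y.

Definition agree (D : Type) (U V : D -> Prop) (RU RV : relation D) : Prop :=
  forall x y, U x -> V x -> U y -> V y -> (RU x y <-> RV x y).

Definition gluable (D : Type) (L : relation D) (U V : D -> Prop)
    (RU RV : relation D) : Prop :=
  absorbing L U RU /\ absorbing L V RV /\
  interpolates L U V /\ interpolates L V U /\ agree U V RU RV.

Lemma gluable_sym (D : Type) (L : relation D) (U V : D -> Prop)
    (RU RV : relation D) :
  gluable L U V RU RV -> gluable L V U RV RU.
Proof.
  intros (HU & HV & HUV & HVU & Hag).
  refine (conj HV (conj HU (conj HVU (conj HUV _)))).
  intros x y; symmetry; apply Hag; assumption.
Qed.

(** Normal form of an alternating chain. No L-step is kept between the two steps: it can be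
    interpolated in the common part and absorbed on both sides. *)
Inductive short_chain (D : Type) (RU RV : relation D) (x y : D) : Prop :=
| chain1 : RU x y -> short_chain RU RV x y
| chain2 z : RU x z -> RV z y -> short_chain RU RV x y.

(** The L-steps at the ends reach points of D outside U and V. The two constructors make the
    relation symmetric in [RU] and [RV]. *)
Inductive glue (D : Type) (L RU RV : relation D) (x y : D) : Prop :=
| glue_l u v : L x u -> short_chain RU RV u v -> L v y -> glue L RU RV x y
| glue_r u v : L x u -> short_chain RV RU u v -> L v y -> glue L RU RV x y.

Lemma glue_sym (D : Type) (L RU RV : relation D) (x y : D) :
  glue L RU RV x y -> glue L RV RU x y.
Proof.
  intros [u v ? ? ?|u v ? ? ?]; [eapply glue_r|eapply glue_l]; eassumption.
Qed.

(** * Transitivity, conservativity and cycles of the glued relation *)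

Section Glue.

Variables (D : Type) (L : relation D).
Hypothesis (L_order : order D L).

Let Lrefl : forall x, L x x := ord_refl _ _ L_order.
Let Ltrans : forall x y z, L x y -> L y z -> L x z := ord_trans _ _ L_order.

Lemma glue_absorb_l (RU RV : relation D) w x y :
  L w x -> glue L RU RV x y -> glue L RU RV w y.
Proof.
  intros Hw [u v ? ? ?|u v ? ? ?]; [apply glue_l with u v|apply glue_r with u v];
    eauto.
Qed.

Lemma glue_absorb_r (RU RV : relation D) x y z :
  glue L RU RV x y -> L y z -> glue L RU RV x z.
Proof.
  intros [u v ? ? ?|u v ? ? ?] Hz; [apply glue_l with u v|apply glue_r with u v];
    eauto.
Qed.

Lemma glue_incl_l (RU RV : relation D) x y : RU x y -> glue L RU RV x y.
Proof. intros H; eapply glue_l; [apply Lrefl|apply chain1, H|apply Lrefl]. Qed.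

Lemma glue_incl_r (RU RV : relation D) x y : RV x y -> glue L RU RV x y.
Proof. intros H; apply glue_sym, glue_incl_l, H. Qed.

Lemma glue_sub (RU RV T : relation D) :
  transitive D T -> inclusion D L T -> inclusion D RU T -> inclusion D RV T ->
  inclusion D (glue L RU RV) T.
Proof.
  unfold inclusion, transitive; intros Htr HL HU HV x y [u v ? Huv ?|u v ? Huv ?];
    (apply Htr with u; [auto|]; apply Htr with v; [|auto]);
    destruct Huv as [?|z ? ?]; eauto.
Qed.

(** When the chain ends in V, the L-step back to U passes through a common point [w]. Then [z] and
    [w] are both common, [RV z w] is also an [RU]-step by agreement, and the chain collapses to one
    [RU]-step. *)
Lemma short_chain_step_l U V (RU RV : relation D) u v u' v' :
  gluable L U V RU RV ->
  short_chain RU RV u v -> L v u' -> RU u' v' -> short_chain RU RV u v'.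
Proof.
  intros (HU & HV & _ & HVU & Hag) [Huv|z Huz Hzv] Hvu H'.
  - apply chain1; eapply (abs_trans HU); [exact Huv|].
    eapply (abs_left HU); [apply (abs_supp HU Huv)|exact Hvu|exact H'].
  - destruct (HVU v u') as (w & Vw & Uw & Hvw & Hwu);
      [apply (abs_supp HV Hzv)|apply (abs_supp HU H')|exact Hvu|].
    assert (Hzw : RV z w) by (eapply (abs_right HV); eassumption).
    apply Hag in Hzw; try assumption;
      [|apply (abs_supp HU Huz)|apply (abs_supp HV Hzv)].
    apply chain1; eapply (abs_trans HU); [exact Huz|].
    eapply (abs_trans HU); [exact Hzw|].
    eapply (abs_left HU); eassumption.
Qed.

(** The interpolant of a crossing from U to V becomes the middle point of the chain; after an
    [RV]-step the new step merges into it. *)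
Lemma short_chain_step_r U V (RU RV : relation D) u v u' v' :
  gluable L U V RU RV ->
  short_chain RU RV u v -> L v u' -> RV u' v' -> short_chain RU RV u v'.
Proof.
  intros (HU & HV & HUV & _ & Hag) [Huv|z Huz Hzv] Hvu H'.
  - destruct (HUV v u') as (w & Uw & Vw & Hvw & Hwu);
      [apply (abs_supp HU Huv)|apply (abs_supp HV H')|exact Hvu|].
    apply chain2 with w; [eapply (abs_right HU)|eapply (abs_left HV)]; eassumption.
  - apply chain2 with z; [exact Huz|].
    eapply (abs_trans HV); [exact Hzv|].
    eapply (abs_left HV); [apply (abs_supp HV Hzv)|exact Hvu|exact H'].
Qed.

(** The steps of the second chain are appended one at a time, and the normal form is restored after
    each. *)
Lemma short_chain_glue U V (RU RV : relation D) u v y :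
  gluable L U V RU RV ->
  short_chain RU RV u v -> glue L RU RV v y -> glue L RU RV u y.
Proof.
  intros HG Huv Hvy.
  assert (stepU : forall s t t', short_chain RU RV u s -> L s t -> RU t t' ->
            short_chain RU RV u t')
    by (intros; eapply short_chain_step_l; eassumption).
  assert (stepV : forall s t t', short_chain RU RV u s -> L s t -> RV t t' ->
            short_chain RU RV u t')
    by (intros; eapply short_chain_step_r; eassumption).
  destruct Hvy as [u' v' ? [?|z ? ?] ?|u' v' ? [?|z ? ?] ?];
    (apply glue_l with u v'; [apply Lrefl| |assumption]); eauto.
Qed.

Lemma glue_trans U V (RU RV : relation D) :
  gluable L U V RU RV -> transitive D (glue L RU RV).
Proof.
  intros HG x y z [u v Hxu Huv Hvy|u v Hxu Huv Hvy] Hyz;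
    apply (glue_absorb_l Hxu).
  - eapply short_chain_glue; [exact HG|exact Huv|].
    eapply glue_absorb_l; eassumption.
  - apply glue_sym; eapply short_chain_glue;
      [apply gluable_sym, HG|exact Huv|].
    apply glue_sym; eapply glue_absorb_l; eassumption.
Qed.

(** Interpolating wherever the chain crosses moves each [RV]-step to common points, where it is an
    [RU]-step too. *)
Lemma glue_conservative U V (RU RV : relation D) x y :
  gluable L U V RU RV -> U x -> U y -> glue L RU RV x y -> RU x y.
Proof.
  intros (HU & HV & HUV & HVU & Hag) Ux Uy.
  assert (wide : forall u v, L x u -> RU u v -> L v y -> RU x y).
  { intros u v Hxu Huv Hvy; eapply (abs_left HU); [exact Ux|exact Hxu|].
    eapply (abs_right HU); eassumption. }
  intros [u v Hxu [Huv|z Huz Hzv] Hvy|u v Hxu [Huv|z Huz Hzv] Hvy].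
  - eauto.
  - destruct (HVU v y) as (w & Vw & Uw & Hvw & Hwy);
      [apply (abs_supp HV Hzv)|exact Uy|exact Hvy|].
    assert (Hzw : RV z w) by (eapply (abs_right HV); eassumption).
    apply Hag in Hzw; try assumption;
      [|apply (abs_supp HU Huz)|apply (abs_supp HV Hzv)].
    apply (wide u w); try assumption; eapply (abs_trans HU); eassumption.
  (* A lone [RV]-step is entered from U and left towards U, so both crossings are interpolated. *)
  - destruct (abs_supp HV Huv) as [Vu Vv].
    destruct (HUV x u) as (w & Uw & Vw & Hxw & Hwu); try assumption.
    destruct (HVU v y) as (w' & Vw' & Uw' & Hvw & Hwy); try assumption.
    apply (wide w w'); try assumption; apply Hag; try assumption.
    eapply (abs_left HV); [exact Vw|exact Hwu|].
    eapply (abs_right HV); eassumption.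
  - destruct (HUV x u) as (w & Uw & Vw & Hxw & Hwu);
      [exact Ux|apply (abs_supp HV Huz)|exact Hxu|].
    assert (Hwz : RV w z) by (eapply (abs_left HV); eassumption).
    apply Hag in Hwz; try assumption;
      [|apply (abs_supp HU Hzv)|apply (abs_supp HV Huz)].
    apply (wide w v); try assumption; eapply (abs_trans HU); eassumption.
Qed.

(** A loop at [x], which may lie outside U and V, is rotated to start at the first point of its
    chain; conservativity makes it a loop of [RU] or [RV]. *)
Lemma glue_irrefl U V (RU RV : relation D) :
  gluable L U V RU RV -> (forall x, ~ RU x x) -> (forall x, ~ RV x x) ->
  forall x, ~ glue L RU RV x x.
Proof.
  assert (main : forall U V RU RV, gluable L U V RU RV -> (forall x, ~ RU x x) ->
            forall x u v, L x u -> short_chain RU RV u v -> L v x -> False).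
  { clear U V RU RV; intros U V RU RV HG HU x u v Hxu Huv Hvx; apply (HU u).
    assert (Uu : U u)
      by (destruct HG as [HA _], Huv as [H|z H _]; apply (abs_supp HA H)).
    apply (glue_conservative HG Uu Uu).
    eapply glue_l; [apply Lrefl|exact Huv|eapply Ltrans; eassumption]. }
  intros HG HU HV x [u v Hxu Huv Hvx|u v Hxu Huv Hvx].
  - exact (main _ _ _ _ HG HU _ _ _ Hxu Huv Hvx).
  - exact (main _ _ _ _ (gluable_sym HG) HV _ _ _ Hxu Huv Hvx).
Qed.

(* On a <<-cycle all elements of the chain witnessing x << y coincide. *)
Lemma glue_cycle U V (RU RV : relation D) x y :
  gluable L U V RU RV -> antisymmetric D RU -> antisymmetric D RV ->
  glue L RU RV x y -> glue L RU RV y x -> L x y.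
Proof.
  assert (main : forall U V RU RV, gluable L U V RU RV ->
            antisymmetric D RU -> antisymmetric D RV ->
            forall x y u v, L x u -> short_chain RU RV u v -> L v y ->
            glue L RU RV y x -> L x y).
  { clear U V RU RV x y; intros U V RU RV HG HU HV x y u v Hxu Huv Hvy Hyx.
    assert (Hvu : glue L RU RV v u)
      by (eapply glue_absorb_l; [exact Hvy|]; eapply glue_absorb_r; eassumption).
    assert (E : u = v); [|subst v; eapply Ltrans; eassumption].
    assert (HA := proj1 HG); assert (HB := proj1 (proj2 HG)).
    destruct Huv as [Huv|z Huz Hzv].
    - apply HU; [exact Huv|].
      apply (glue_conservative HG); try exact Hvu; apply (abs_supp HA Huv).
    - transitivity z.
      + apply HU; [exact Huz|].
        apply (glue_conservative HG); try apply (abs_supp HA Huz).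
        eapply (glue_trans HG); [apply glue_incl_r, Hzv|exact Hvu].
      + apply HV; [exact Hzv|].
        apply (glue_conservative (gluable_sym HG)); try apply (abs_supp HB Hzv).
        apply glue_sym.
        eapply (glue_trans HG); [exact Hvu|apply glue_incl_l, Huz]. }
  intros HG HU HV [u v Hxu Huv Hvy|u v Hxu Huv Hvy] Hyx.
  - exact (main _ _ _ _ HG HU HV _ _ _ _ Hxu Huv Hvy Hyx).
  - exact (main _ _ _ _ (gluable_sym HG) HV HU _ _ _ _ Hxu Huv Hvy (glue_sym Hyx)).
Qed.

End Glue.

(** * Relations satisfying the required properties on a part of an ordered set *)

(** With [U] all of [D] these are the conditions on << in the expanded class. On a part, 2, C, A1
    and A2 are asked only at points of [U], where [R] can hold. *)
Record good_on (D : Type) (leD : relation D) (Q : rel_property -> Prop)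
    (N : condition -> Prop) (U : D -> Prop) (R : relation D) : Prop := {
  good_supp : forall x y, R x y -> U x /\ U y;
  good_trans : forall x y z, R x y -> R y z -> R x z;
  good_2 : Q P2 -> forall x, U x -> R x x;
  good_4 : Q P4 -> forall x, ~ R x x;
  good_5 : Q P5 -> antisymmetric D R;
  good_F : N F -> inclusion D R leD;
  good_C : N C -> forall x y, U x -> U y -> leD x y -> R x y;
  good_A1 : N A1 -> forall w x y, U w -> leD w x -> R x y -> R w y;
  good_A2 : N A2 -> forall x y z, U z -> R x y -> leD y z -> R x z
}.

Definition common_extension (D : Type) (leD : relation D)
    (Q : rel_property -> Prop) (N : condition -> Prop) (U V : D -> Prop)
    (RU RV R : relation D) : Prop :=
  (forall x y, U x -> U y -> (R x y <-> RU x y)) /\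
  (forall x y, V x -> V y -> (R x y <-> RV x y)) /\
  good_on leD Q N (fun _ => True) R.

(** * Two constructions of a common extension *)

Section Extension.

Variables (D : Type) (leD : relation D).
Hypothesis (le_ord : order D leD).
Variables (Q : rel_property -> Prop) (N : condition -> Prop).
Variables (U V : D -> Prop) (RU RV : relation D).
Hypotheses (HU : good_on leD Q N U RU) (HV : good_on leD Q N V RV).
Hypothesis (Hag : agree U V RU RV).
Hypothesis (consistent : ~ (Q P4 /\ (N C \/ Q P2))).

(** A glued pair uses at least one [RU]- or [RV]-step, so bare L-pairs are added when C or
    reflexivity is required; they already belong to [RU] and [RV] on the two parts, hence nothing
    new appears there. *)
Lemma extension_by_glue (L : relation D) :
  order D L -> inclusion D L leD -> gluable L U V RU RV ->
  (N C \/ N A1 \/ N A2 -> inclusion D leD L) ->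
  (N C \/ Q P2 -> forall x y, U x -> U y -> L x y -> RU x y) ->
  (N C \/ Q P2 -> forall x y, V x -> V y -> L x y -> RV x y) ->
  exists R, common_extension leD Q N U V RU RV R.
Proof.
  intros HL HLle HG HleL HLU HLV.
  assert (Ltrans := ord_trans _ _ HL); red in Ltrans.
  assert (abl := @glue_absorb_l _ _ HL RU RV).
  assert (abr := @glue_absorb_r _ _ HL RU RV).
  assert (gtr := glue_trans HL HG); red in gtr.
  exists (fun x y => (N C \/ Q P2) /\ L x y \/ glue L RU RV x y).
  split; [|split; [|split]].
  - intros x y Ux Uy; split.
    + intros [[Hr Hxy]|Hxy]; [eauto|].
      exact (glue_conservative HG Ux Uy Hxy).
    + intros Hxy; right; apply (glue_incl_l HL); exact Hxy.
  - intros x y Vx Vy; split.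
    + intros [[Hr Hxy]|Hxy]; [eauto|].
      exact (glue_conservative (gluable_sym HG) Vx Vy (glue_sym Hxy)).
    + intros Hxy; right; apply (glue_incl_r HL); exact Hxy.
  - auto.
  - intros x y z [[Hr Hxy]|Hxy] [[_ Hyz]|Hyz].
    + left; eauto.
    + right; eauto.
    + right; eauto.
    + right; eauto.
  - intros HQ x _; left; split; [right; exact HQ|apply (ord_refl _ _ HL)].
  - intros HQ x [[Hr _]|Hx]; [apply consistent; auto|].
    exact (glue_irrefl HL HG (good_4 HU HQ) (good_4 HV HQ) Hx).
  - intros HQ.
    assert (cyc := fun x y => @glue_cycle _ _ HL _ _ _ _ x y HG
                     (good_5 HU HQ) (good_5 HV HQ)).
    (* For a mixed cycle, with [x] L [y] and a glued pair from [y] to [x], the glued pair from [x]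
       to [y] is read off x L y << x L y. *)
    intros x y [[_ Hxy]|Hxy] [[_ Hyx]|Hyx]; apply (ord_antisym _ _ HL);
      try assumption; apply cyc; eauto.
  - intros HF x y [[_ Hxy]|Hxy]; [apply HLle, Hxy|].
    exact (glue_sub (ord_trans _ _ le_ord) HLle (good_F HU HF) (good_F HV HF) Hxy).
  - intros HC x y _ _ Hxy; left; split; [auto|apply HleL; auto].
  - intros HA w x y _ Hwx Hxy; apply HleL in Hwx; [|auto].
    destruct Hxy as [[Hr Hxy]|Hxy]; [left|right]; eauto.
  - intros HA x y z _ Hxy Hyz; apply HleL in Hyz; [|auto].
    destruct Hxy as [[Hr Hxy]|Hxy]; [left|right]; eauto.
Qed.

(** The relation is <= followed by one step of [RU] or [RV]. By F it lies inside <=, which gives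
    antisymmetry, and also transitivity, since the first of two pairs is absorbed as a <=-step. *)
Lemma extension_by_left_closure :
  interpolates leD U V -> interpolates leD V U ->
  N F -> N A1 -> ~ N A2 -> ~ N C -> ~ Q P2 ->
  exists R, common_extension leD Q N U V RU RV R.
Proof.
  intros HUV HVU NF NA1 NA2 NC Q2.
  assert (tr := ord_trans _ _ le_ord); assert (rf := ord_refl _ _ le_ord).
  red in tr, rf.
  exists (fun x y => exists u, leD x u /\ (RU u y \/ RV u y)).
  assert (sub : forall x y, (exists u, leD x u /\ (RU u y \/ RV u y)) -> leD x y).
  { intros x y (u & Hxu & [H|H]); apply (tr _ _ _ Hxu);
      [apply (good_F HU NF)|apply (good_F HV NF)]; exact H. }
  split; [|split; [|split; try contradiction]].
  - intros x y Ux Uy; split; [|intros H; exists x; auto].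
    intros (u & Hxu & [H|H]).
    + eapply (good_A1 HU); eassumption.
    (* Here [y] is common, so only the crossing from [x] to [u] is interpolated; A1 in V then yields
       a step between common points. *)
    + destruct (good_supp HV H) as [Vu Vy].
      destruct (HUV x u) as (z & Uz & Vz & Hxz & Hzu); try assumption.
      eapply (good_A1 HU); try eassumption; apply Hag; try assumption.
      eapply (good_A1 HV); eassumption.
  - intros x y Vx Vy; split; [|intros H; exists x; auto].
    intros (u & Hxu & [H|H]).
    + destruct (good_supp HU H) as [Uu Uy].
      destruct (HVU x u) as (z & Vz & Uz & Hxz & Hzu); try assumption.
      eapply (good_A1 HV); try eassumption; apply Hag; try assumption.
      eapply (good_A1 HU); eassumption.
    + eapply (good_A1 HV); eassumption.
  - auto.
  - intros x y z Hxy (u & Hyu & H); exists u; eauto.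
  - intros HQ x (u & Hxu & H).
    (* By F, x <= u << x gives u <= x, so the loop is one of [RU] or [RV]. *)
    assert (E : x = u); [apply (ord_antisym _ _ le_ord); [exact Hxu|]|subst u].
    + apply sub; exists u; auto.
    + destruct H as [H|H]; [exact (good_4 HU HQ H)|exact (good_4 HV HQ H)].
  - intros _ x y Hxy Hyx; apply (ord_antisym _ _ le_ord); auto.
  - exact (fun _ => sub).
  - intros _ w x y _ Hwx (u & Hxu & H); exists u; eauto.
Qed.

End Extension.

(** * Duality: reversing both relations exchanges A1 and A2 *)

Definition converse_condition (n : condition) : condition :=
  match n with F => F | C => C | A1 => A2 | A2 => A1 end.

Lemma good_on_converse (D : Type) (leD : relation D) (Q : rel_property -> Prop)
    (N : condition -> Prop) (U : D -> Prop) (R : relation D) :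
  good_on leD Q N U R ->
  good_on (transp D leD) Q (fun n => N (converse_condition n)) U (transp D R).
Proof.
  unfold transp; intros []; split; unfold inclusion, antisymmetric in *; simpl;
    try (intros; eauto; fail).
  intros x y H; apply and_comm; auto.
Qed.

Lemma interpolates_eq (D : Type) (U V : D -> Prop) : interpolates eq U V.
Proof. intros x y Ux Vy <-; exists x; auto. Qed.

(** * Existence of a common extension, by cases on the conditions *)

Section ExtensionExists.

Variables (D : Type) (leD : relation D).
Hypothesis (le_ord : order D leD).
Variables (Q : rel_property -> Prop) (N : condition -> Prop).
Variables (U V : D -> Prop) (RU RV : relation D).
Hypotheses (HU : good_on leD Q N U RU) (HV : good_on leD Q N V RV).
Hypothesis (Hag : agree U V RU RV).
Hypotheses (HUV : interpolates leD U V) (HVU : interpolates leD V U).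
Hypothesis (consistent : ~ (Q P4 /\ (N C \/ Q P2))).

(** The left closure is applied to the transposed relations, and its result is transposed back. *)
Lemma extension_by_right_closure :
  N F -> N A2 -> ~ N A1 -> ~ N C -> ~ Q P2 ->
  exists R, common_extension leD Q N U V RU RV R.
Proof.
  intros NF NA2 NA1 NC Q2.
  destruct (@extension_by_left_closure D (transp D leD)) with
    (Q := Q) (N := fun n => N (converse_condition n)) (U := U) (V := V)
    (RU := transp D RU) (RV := transp D RV) as (R & H1 & H2 & H3);
    try assumption.
  - destruct le_ord; split; unfold transp; red; eauto.
  - apply good_on_converse, HU.
  - apply good_on_converse, HV.
  - intros x y; unfold transp; intros; apply Hag; assumption.
  (* Reversing the order swaps the two interpolation hypotheses. *)
  - intros x y Ux Vy Hxy; destruct (HVU Vy Ux Hxy) as (z & ? & ? & ? & ?);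
      exists z; auto.
  - intros x y Vx Uy Hxy; destruct (HUV Uy Vx Hxy) as (z & ? & ? & ? & ?);
      exists z; auto.
  - exists (transp D R); split; [|split].
    + intros x y Ux Uy; exact (H1 y x Uy Ux).
    + intros x y Vx Vy; exact (H2 y x Vy Vx).
    + destruct H3; split; unfold transp, inclusion, antisymmetric in *; simpl in *;
        try (intros; eauto; fail).
Qed.

(** Under C, or under 2 with A1 or A2 (from x <= y << y or x << x <= y), <= lies inside << and
    transitivity absorbs it. In the remaining case A1 and A2 are the two absorptions. *)
Lemma good_on_absorbing (W : D -> Prop) (R : relation D) :
  good_on leD Q N W R ->
  (N A1 /\ N A2) \/ N C \/ (N F /\ Q P2 /\ (N A1 \/ N A2)) ->
  absorbing leD W R /\
  (N C \/ Q P2 -> forall x y, W x -> W y -> leD x y -> R x y).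
Proof.
  intros HR HN.
  assert (incl : N C \/ Q P2 -> forall x y, W x -> W y -> leD x y -> R x y).
  { assert (byA : N A1 \/ N A2 -> Q P2 ->
              forall x y, W x -> W y -> leD x y -> R x y).
    { intros [NA|NA] Q2 x y Wx Wy Hxy.
      - apply (good_A1 HR NA) with y; try assumption; apply (good_2 HR Q2 Wy).
      - apply (good_A2 HR NA) with x; try assumption; apply (good_2 HR Q2 Wx). }
    intros [NC|Q2]; [exact (good_C HR NC)|].
    destruct HN as [[NA _]|[NC|(_ & _ & NA)]];
      [apply byA; auto|exact (good_C HR NC)|apply byA; auto]. }
  split; [|exact incl]; split.
  - apply (good_supp HR).
  - apply (good_trans HR).
  - intros w x y Ww Hwx Hxy; destruct (classic (N C \/ Q P2)) as [Hr|Hr].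
    + apply (good_trans HR) with x; [|exact Hxy].
      apply incl; try assumption; apply (good_supp HR Hxy).
    + destruct HN as [[NA _]|[NC|(_ & Q2 & _)]]; [|tauto|tauto].
      eapply (good_A1 HR); eassumption.
  - intros x y z Wz Hxy Hyz; destruct (classic (N C \/ Q P2)) as [Hr|Hr].
    + apply (good_trans HR) with y; [exact Hxy|].
      apply incl; try assumption; apply (good_supp HR Hxy).
    + destruct HN as [[_ NA]|[NC|(_ & Q2 & _)]]; [|tauto|tauto].
      eapply (good_A2 HR); eassumption.
Qed.

Lemma common_extension_exists :
  (N A1 /\ N A2) \/ (~ N A1 /\ ~ N A2) \/ N F ->
  exists R, common_extension leD Q N U V RU RV R.
Proof.
  intros hN.
  destruct (classic ((N A1 /\ N A2) \/ N C \/ (N F /\ Q P2 /\ (N A1 \/ N A2))))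
    as [HI|HI].
  { destruct (good_on_absorbing HU HI) as [absU inclU].
    destruct (good_on_absorbing HV HI) as [absV inclV].
    apply (extension_by_glue le_ord HU HV consistent le_ord); try assumption;
      try (intros x y H; exact H).
    - exact (conj absU (conj absV (conj HUV (conj HVU Hag)))).
    - intros _ x y H; exact H. }
  (* Failure of [HI] excludes C. If just one of A1, A2 holds, [hN] leaves F, and failure of [HI]
     then excludes 2, so a one-sided closure applies. *)
  destruct (classic (N A1)) as [NA1|NA1].
  { apply extension_by_left_closure; tauto. }
  destruct (classic (N A2)) as [NA2|NA2].
  { apply extension_by_right_closure; tauto. }
  (* None of A1, A2, C is required now, so equality can serve as [L]: every relation absorbs it, and
     a point in both parts is its own interpolant. *)
  assert (abs_eq : forall W R, good_on leD Q N W R -> absorbing eq W R).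
  { intros W R HR; split; [apply (good_supp HR)|apply (good_trans HR)| |].
    - intros w x y _ ->; auto.
    - intros x y z _ H <-; exact H. }
  apply (extension_by_glue le_ord HU HV consistent) with (L := eq).
  - split; red; [reflexivity|intros x y z -> ->; reflexivity|auto].
  - intros x y <-; apply (ord_refl _ _ le_ord).
  - exact (conj (abs_eq _ _ HU) (conj (abs_eq _ _ HV)
             (conj (interpolates_eq (V := V)) (conj (interpolates_eq (V := U)) Hag)))).
  - tauto.
  - intros [NC|Q2] x y Ux _ <-; [tauto|exact (good_2 HU Q2 Ux)].
  - intros [NC|Q2] x y Vx _ <-; [tauto|exact (good_2 HV Q2 Vx)].
Qed.

End ExtensionExists.

(** * Expansions by a binary relation *)

Definition expand (S : signature) (D : ordered_structure S) (R : relation D)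
  : ordered_structure (add_binary S) :=
  @OrderedStructure (add_binary S) (carrier D) (@le _ D) (le_order D)
    (fun r => match r return Vector.t D (rel_arity (s := add_binary S) r) -> Prop
              with
              | None => fun v => R (Vector.hd v) (Vector.hd (Vector.tl v))
              | Some r => @rel_interp _ D r
              end)
    (@fun_interp _ D).

Lemma reduct_expand (S : signature) (D : ordered_structure S) (R : relation D) :
  reduct (expand R) = D.
Proof. destruct D; reflexivity. Qed.

Lemma embedding_reduct (S : signature) (A B : ordered_structure (add_binary S))
    (h : A -> B) :
  is_embedding h -> @is_embedding S (reduct A) (reduct B) h.
Proof.
  intros H; split.
  - apply (emb_inj H).
  - apply (emb_le H).
  - exact (fun r => @emb_rel _ _ _ _ H (Some r)).
  - apply (emb_fun H).
Qed.

Lemma embedding_ll (S : signature) (A B : ordered_structure (add_binary S))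
    (h : A -> B) (x y : A) :
  is_embedding h -> (ll x y <-> ll (h x) (h y)).
Proof. intros H; apply (@emb_rel _ _ _ _ H None). Qed.

Lemma embedding_expand (S : signature) (A : ordered_structure (add_binary S))
    (D : ordered_structure S) (R : relation D) (h : A -> D) :
  @is_embedding S (reduct A) D h -> (forall x y : A, R (h x) (h y) <-> ll x y) ->
  @is_embedding (add_binary S) A (expand R) h.
Proof.
  intros H HR; split.
  - apply (emb_inj H).
  - apply (emb_le H).
  - intros [r|] v; [exact (@emb_rel _ _ _ _ H r v)|].
    change (Vector.t A 2) in v.
    (* The argument vector of length 2 is opened into its two entries. *)
    rewrite (Vector.eta v), (Vector.eta (Vector.tl v)).
    generalize (Vector.tl (Vector.tl v)).
    apply Vector.case0; symmetry; apply HR.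
  - apply (emb_fun H).
Qed.

(** * Amalgams of empty structures *)

Lemma vector_from_empty (X Y Z : Type) (f : X -> Y) (g : X -> Z) (h : Y -> Z)
    (n : nat) (v : Vector.t Y n) :
  (Y -> False) -> exists w, Vector.map f w = v /\ Vector.map g w = Vector.map h v.
Proof.
  intros HY; destruct v as [|y n v]; [|destruct (HY y)].
  exists (Vector.nil X); auto.
Qed.

(* Nullary relations still have to be compared, through the common part. *)
Lemma superamalgam_of_empty (S : signature) (K : structure_class S)
    (A B E : ordered_structure S) (iota1 : E -> A) (kappa1 : E -> B) :
  K A -> is_embedding iota1 -> is_embedding kappa1 ->
  (A -> False) -> (B -> False) ->
  exists (D : ordered_structure S) (iota : A -> D) (kappa : B -> D),
    K D /\ is_embedding iota /\ is_embedding kappa /\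
    (forall c : E, iota (iota1 c) = kappa (kappa1 c)) /\
    (forall d : D, in_image iota d /\ in_image kappa d <->
                   in_image (fun c : E => iota (iota1 c)) d) /\
    (forall (a : A) (b : B), ~ in_image iota1 a -> ~ in_image kappa1 b ->
       (le (iota a) (kappa b) ->
          exists c : E, le a (iota1 c) /\ le (kappa1 c) b) /\
       (le (kappa b) (iota a) ->
          exists c : E, le b (kappa1 c) /\ le (iota1 c) a)).
Proof.
  intros KA H1 H2 HA HB.
  exists A, (fun a => a), (fun b => False_rect A (HB b)).
  split; [exact KA|split; [|split; [|split; [|split]]]];
    try (intros x; exfalso; apply HA; exact x || exact (iota1 x)).
  - split; try (intros x; destruct (HA x)); try (intros r v).
    + rewrite (Vector.map_id _ _ v); reflexivity.
    + destruct (HA (fun_interp v)).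
  - split; try (intros x; destruct (HB x)); intros r v.
    + destruct (vector_from_empty kappa1 iota1 (fun b => False_rect A (HB b)) v HB)
        as (w & <- & <-).
      rewrite <- (emb_rel H1), <- (emb_rel H2); reflexivity.
    + destruct (HB (fun_interp v)).
Qed.

(** * Transport of << to the image of an embedding *)

Definition image_rel (X Y : Type) (h : X -> Y) (R : relation X) : relation Y :=
  fun x y => exists a b, h a = x /\ h b = y /\ R a b.

Lemma image_relE (X Y : Type) (h : X -> Y) (R : relation X) (a b : X) :
  (forall x y, h x = h y -> x = y) -> (image_rel h R (h a) (h b) <-> R a b).
Proof.
  intros inj; split; [|intros H; exists a, b; auto].
  intros (a' & b' & Ha & Hb & H); apply inj in Ha, Hb; subst; exact H.
Qed.

Lemma good_on_image (S : signature) (K : structure_class S)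
    (Q : rel_property -> Prop) (N : condition -> Prop)
    (A : ordered_structure (add_binary S)) (D : ordered_structure S) (h : A -> D) :
  expansion_class K Q N A -> @is_embedding S (reduct A) D h ->
  good_on (@le _ D) Q N (in_image h) (image_rel h (@ll S A)).
Proof.
  intros (_ & tr & HQ & HN) Hh.
  assert (inj := emb_inj Hh); assert (Hle := emb_le Hh); simpl in *.
  split.
  - intros x y (a & b & <- & <- & _); split; eexists; reflexivity.
  - intros x y z (a & b & <- & <- & Hab) (b' & c & Hb & <- & Hbc).
    apply inj in Hb; subst b'; apply image_relE; [exact inj|eapply tr; eassumption].
  - intros q x [a <-]; apply image_relE; [exact inj|exact (HQ _ q a)].
  - intros q x (a & b & <- & Hb & Hab); apply inj in Hb; subst b.
    exact (HQ _ q a Hab).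
  - intros q x y (a & b & <- & <- & Hab) Hba; apply image_relE in Hba; [|exact inj].
    f_equal; exact (HQ _ q a b Hab Hba).
  - intros n x y (a & b & <- & <- & Hab); apply Hle; exact (HN _ n a b Hab).
  - intros n x y [a <-] [b <-] Hab; apply image_relE; [exact inj|].
    apply (HN _ n); apply Hle, Hab.
  - intros n w x y [d <-] Hdx (a & b & <- & <- & Hab); apply image_relE;
      [exact inj|].
    apply (HN _ n) with a; [apply Hle, Hdx|exact Hab].
  - intros n x y z [d <-] (a & b & <- & <- & Hab) Hyd; apply image_relE;
      [exact inj|].
    apply (HN _ n) with b; [exact Hab|apply Hle, Hyd].
Qed.

(** An element x would satisfy x << x, by 2 or by C applied to x <= x, against 4. *)
Lemma expansion_class_empty (S : signature) (K : structure_class S)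
    (Q : rel_property -> Prop) (N : condition -> Prop)
    (A : ordered_structure (add_binary S)) :
  Q P4 -> N C \/ Q P2 -> expansion_class K Q N A -> A -> False.
Proof.
  intros Q4 Hr (_ & _ & HQ & HN) a; apply (HQ _ Q4 a).
  destruct Hr as [NC|Q2]; [|exact (HQ _ Q2 a)].
  apply (HN _ NC), (ord_refl _ _ (le_order A)).
Qed.

Lemma expand_in_class (S : signature) (K : structure_class S)
    (Q : rel_property -> Prop) (N : condition -> Prop)
    (D : ordered_structure S) (R : relation D) :
  K D -> good_on (@le _ D) Q N (fun _ => True) R ->
  expansion_class K Q N (expand R).
Proof.
  intros KD HR; split; [rewrite reduct_expand; exact KD|split; [|split]].
  - exact (good_trans HR).
  - intros [| |] q.
    + exact (fun x => good_2 HR q I).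
    + exact (good_4 HR q).
    + exact (good_5 HR q).
  - intros [| | |] n.
    + exact (good_F HR n).
    + exact (fun x y => good_C HR n I I).
    + exact (fun w x y => good_A1 HR n I).
    + exact (fun x y z => good_A2 HR n I).
Qed.

(** * Superamalgamation of the expanded class *)

Theorem theorem4p2 (S : signature) (K : structure_class S)
    (K_nonempty : nonempty_class K)
    (K_iso : iso_closed K)
    (K_super : superamalgamation K)
    (Q : rel_property -> Prop) (N : condition -> Prop)
    (hN : (N A1 /\ N A2) \/ (~ N A1 /\ ~ N A2) \/ N F) :
  superamalgamation (expansion_class K Q N).
Proof.
  intros A B E iota1 kappa1 KA KB KE H1 H2.
  (* If 4 meets C or 2, A and B are empty and are amalgamated separately. *)
  destruct (classic (Q P4 /\ (N C \/ Q P2))) as [[Q4 Hr]|consistent].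
  { apply superamalgam_of_empty; try assumption;
      eapply expansion_class_empty; eassumption. }
  destruct (K_super (reduct A) (reduct B) (reduct E) iota1 kappa1)
    as (D & iota & kappa & KD & Hi & Hk & Hcomm & Himg & Hsup);
    try apply KA; try apply KB; try apply KE; try (apply embedding_reduct; assumption).
  (* By the intersection clause, points of A and B identified in D come from a single point of E. *)
  assert (over_E : forall a b, iota a = kappa b ->
            exists e : E, a = iota1 e /\ b = kappa1 e).
  { intros a b Hab.
    destruct (proj1 (Himg (iota a))) as [e He].
    { split; [exists a|exists b]; auto. }
    exists e; split; [apply (emb_inj Hi)|apply (emb_inj Hk)].
    - symmetry; exact He.
    - rewrite <- Hab, <- He; apply Hcomm. }
  (* The superamalgamation clause covers only points outside the image of E; a point coming from E
     is its own interpolant. *)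
  assert (HUV : interpolates (@le _ D) (in_image iota) (in_image kappa)).
  { intros x y [a <-] [b <-] Hab.
    destruct (classic (in_image iota1 a)) as [[e <-]|Ha].
    { exists (iota (iota1 e)); repeat split;
        [exists (iota1 e)|exists (kappa1 e)| |exact Hab]; auto.
      apply (ord_refl _ _ (le_order D)). }
    destruct (classic (in_image kappa1 b)) as [[e <-]|Hb].
    { exists (iota (iota1 e)); repeat split;
        [exists (iota1 e)|exists (kappa1 e)|rewrite Hcomm; exact Hab|]; auto.
      rewrite Hcomm; apply (ord_refl _ _ (le_order D)). }
    destruct (proj1 (Hsup a b Ha Hb) Hab) as (e & Hae & Heb).
    exists (iota (iota1 e)); repeat split;
      [exists (iota1 e)|exists (kappa1 e)| |]; auto.
    - apply (emb_le Hi); exact Hae.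
    - rewrite Hcomm; apply (emb_le Hk); exact Heb. }
  assert (HVU : interpolates (@le _ D) (in_image kappa) (in_image iota)).
  { intros y x [b <-] [a <-] Hba.
    destruct (classic (in_image iota1 a)) as [[e <-]|Ha].
    { exists (iota (iota1 e)); repeat split;
        [exists (kappa1 e)|exists (iota1 e)|exact Hba|]; auto.
      apply (ord_refl _ _ (le_order D)). }
    destruct (classic (in_image kappa1 b)) as [[e <-]|Hb].
    { exists (iota (iota1 e)); repeat split;
        [exists (kappa1 e)|exists (iota1 e)| |rewrite Hcomm; exact Hba]; auto.
      rewrite Hcomm; apply (ord_refl _ _ (le_order D)). }
    destruct (proj2 (Hsup a b Ha Hb) Hba) as (e & Hbe & Hea).
    exists (iota (iota1 e)); repeat split;
      [exists (kappa1 e)|exists (iota1 e)| |]; auto.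
    - rewrite Hcomm; apply (emb_le Hk); exact Hbe.
    - apply (emb_le Hi); exact Hea. }
  (* Common points come from E, and both embeddings of E preserve and reflect <<. *)
  assert (Hag : agree (in_image iota) (in_image kappa)
                  (image_rel iota (@ll S A)) (image_rel kappa (@ll S B))).
  { intros x y [a <-] [b Hb] [a' <-] [b' Hb'].
    destruct (over_E a b) as (e & -> & ->); [auto|].
    destruct (over_E a' b') as (e' & -> & ->); [auto|].
    rewrite image_relE by apply (emb_inj Hi).
    rewrite !Hcomm, image_relE by apply (emb_inj Hk).
    rewrite <- (embedding_ll e e' H1), <- (embedding_ll e e' H2); reflexivity. }
  destruct (@common_extension_exists D (@le _ D) (le_order D) Q N
              (in_image iota) (in_image kappa) _ _
              (good_on_image KA Hi) (good_on_image KB Hk) Hag HUV HVU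
              consistent hN) as (R & RA & RB & HR).
  (* The carrier and order of D are unchanged, so its commutation, intersection and interpolation
     clauses carry over. *)
  exists (expand R), iota, kappa.
  split; [exact (expand_in_class KD HR)|].
  split; [|split; [|exact (conj Hcomm (conj Himg Hsup))]].
  - apply embedding_expand; [exact Hi|intros a a'].
    rewrite RA by (eexists; reflexivity); apply image_relE, (emb_inj Hi).
  - apply embedding_expand; [exact Hk|intros b b'].
    rewrite RB by (eexists; reflexivity); apply image_relE, (emb_inj Hk).
Qed.
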